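(* Let $m,n,r$ be positive integers. There exists a signed magic rectangle $SMR(m,n;r,2)$ if and only if either $m=2$ and $n=r\equiv 0$ or $3 \pmod 4$, or $m\geq 3$, $r\geq 3$ and $mr=2n$.
   Context: A signed magic rectangle $SMR(m,n;r,s)$ is an $m\times n$ array, some of whose cells are filled with integers and the others empty, such that exactly $r$ cells in every row and exactly $s$ cells in every column are filled (so $mr=ns$), every element of a set $X$ appears exactly once in the array, and the sum of the entries of each row and of each column is zero. Here $X=\{\pm1,\pm2,\ldots,\pm mr/2\}$ if $mr$ is even, and $X=\{0,\pm1,\ldots,\pm (mr-1)/2\}$ if $mr$ is odd. *)

(* Defs.v *)
From mathcomp Require Import all_boot all_order all_algebra.

Set Implicit Arguments.
Unset Strict Implicit.
Unset Printing Implicit Defensive.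

Import GRing.Theory Num.Theory.
Local Open Scope ring_scope.

(* The set X: {±1, ..., ±mr/2} if mr is even, {0, ±1, ..., ±(mr-1)/2} if mr is
   odd; `|x|%N is the natural-number absolute value. *)
Definition smr_entries (m r : nat) : pred int := fun x =>
  if odd (m * r) then (`|x|%N <= (m * r).-1./2)%N
  else (0 < `|x|%N <= (m * r)./2)%N.

(* An empty cell is None. Nothing requires the filled cells to lie in X: there
   are m * r of them and X has m * r elements, each occurring exactly once. In
   the same way m * r = n * s follows by counting the filled cells. *)
Record is_SMR (m n r s : nat) (A : 'M[option int]_(m, n)) : Prop := IsSMR {
  smr_row_filled : forall i : 'I_m, #|[set j : 'I_n | A i j != None]| = r;
  smr_col_filled : forall j : 'I_n, #|[set i : 'I_m | A i j != None]| = s;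
  smr_once : forall x : int, x \in smr_entries m r ->
    #|[set ij : 'I_m * 'I_n | A ij.1 ij.2 == Some x]| = 1%N;
  smr_row_sum : forall i : 'I_m, \sum_(j < n) odflt 0 (A i j) = 0;
  smr_col_sum : forall j : 'I_n, \sum_(i < m) odflt 0 (A i j) = 0
}.

(* Main.v *)
Require Import Defs.
From mathcomp Require Import all_boot all_order all_algebra.
From mathcomp Require Import zify.

Set Implicit Arguments.
Unset Strict Implicit.
Unset Printing Implicit Defensive.

Import GRing.Theory Num.Theory.
Local Open Scope ring_scope.

(* A column with two filled cells and zero sum contains k and -k for some k, so
   up to a permutation of columns an SMR(m,n;r,2) is a partition of
   {+-1,...,+-n} into m zero-sum r-sets, none containing both k and -k.  Given
   a fixed-point-free permutation s of the rows, the 2m new labels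
   n+1,...,n+2m increase r by 4: row i receives n+i+1, n+2m-i, -(n+s(i)+1) and
   -(n+2m-s(i)), because the labels in each of the pairs {n+i+1, n+2m-i} have
   the same sum.  It remains to treat r = 0, 3, 5, 6.  For r = 3 and m = 2k the
   perfect shuffle u -> v = 2u mod 2k+1 of {1,...,2k} has each displacement
   d = v - u in {+-1,...,+-k} exactly once; the rows are (d, k+u, -(k+v)).
   The cases r = 5, 6 come from r = 3, 4 by moving one entry of each row to
   another row and compensating with two new labels whose difference is that of
   the exchanged entries.

   Conversely, for r = 1, 2 the entry 1 cannot be cancelled in its row, and for
   m = 2 a row sums to an integer of the parity of 1 + ... + n. *)

(* [zsr_uniq] rules out both repetitions and opposite entries in a row. *)
Record zero_sum_rows (m n r : nat) (R : nat -> seq int) : Prop := ZeroSumRows {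
  zsr_size : forall i, (i < m)%N -> size (R i) = r;
  zsr_sum : forall i, (i < m)%N -> \sum_(x <- R i) x = 0;
  zsr_uniq : forall i, (i < m)%N -> uniq [seq absz x | x <- R i];
  zsr_bound : forall i x, (i < m)%N -> x \in R i -> (0 < `|x|%N <= n)%N;
  zsr_inj : forall i i' x, (i < m)%N -> (i' < m)%N ->
    x \in R i -> x \in R i' -> i = i'
}.

(** * Derangements of the row indices *)

Definition derangement (m : nat) (s : nat -> nat) : Prop :=
  forall i, (i < m)%N ->
    [/\ (s i < m)%N, s i <> i &
        forall i', (i' < m)%N -> s i = s i' -> i = i'].

Definition cyc_succ (m i : nat) : nat := if (i.+1 < m)%N then i.+1 else 0%N.

Lemma cyc_succ_derangement m : (1 < m)%N -> derangement m (cyc_succ m).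
Proof. by move=> m1 i im; rewrite /cyc_succ; split=> [||i' i'm];
  repeat case: ifP; lia. Qed.

Lemma cyc_succ2_derangement m :
  (2 < m)%N -> derangement m (fun i => cyc_succ m (cyc_succ m i)).
Proof. by move=> m2 i im; rewrite /cyc_succ; split=> [||i' i'm];
  repeat case: ifP; lia. Qed.

(** * Constructions of zero-sum rows *)

Lemma zero_sum_rows_nil m : zero_sum_rows m 0 0 (fun=> [::]).
Proof. by split=> // i _; rewrite big_nil. Qed.

(** As [i] varies, [n + i + 1] fills the lower half of the new labels and [n + 2 * m - i] the upper
    half. Injectivity of [s] prevents repeated negatives, and [s i <> i] keeps opposite labels in
    different rows. *)
Lemma zero_sum_rows_add4 m n r R s : derangement m s ->
  zero_sum_rows m n r R ->
  zero_sum_rows m (n + 2 * m) (r + 4) (fun i => R i ++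
    [:: (n + i + 1)%:Z; (n + 2 * m - i)%:Z;
        - (n + s i + 1)%:Z; - (n + 2 * m - s i)%:Z]).
Proof.
move=> ds [Rsz Rsum Runiq Rbd Rinj]; split=> [i im|i im|i im|i x im|i i' x im i'm].
- by rewrite size_cat Rsz.
- have [sm si _] := ds i im.
  by rewrite big_cat Rsum //= !big_cons big_nil; lia.
- have [sm si _] := ds i im.
  rewrite map_cat cat_uniq Runiq // andTb; apply/andP; split; last first.
    by rewrite /= !inE; lia.
  apply/hasPn=> y yn; apply/negP=> /mapP[x xR yE].
  by have := Rbd _ _ im xR; move: yn; rewrite /= !inE yE; lia.
- have [sm si _] := ds i im.
  rewrite mem_cat => /orP[/(Rbd _ _ im)|]; first lia.
  by rewrite !inE; lia.
- have [sm si /(_ _ i'm) sinj] := ds i im.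
  have [sm' si' _] := ds i' i'm.
  rewrite !mem_cat => /orP[xi|xi] /orP[xi'|xi'].
  + exact: Rinj xi xi'.
  + by have := Rbd _ _ im xi; move: xi'; rewrite !inE; lia.
  + by have := Rbd _ _ i'm xi'; move: xi; rewrite !inE; lia.
  + by move: xi xi'; rewrite !inE; lia.
Qed.

(** Here [u = i + 1]. For [i < k] the double [2u] needs no reduction, so [v = 2u] and [d = u];
    otherwise [v = 2u - (2k + 1)] and [d = u - (2k + 1)]. *)
Lemma zero_sum_rows3 k : zero_sum_rows (2 * k) (3 * k) 3 (fun i =>
  if (i < k)%N then [:: (i + 1)%:Z; (k + i + 1)%:Z; - (k + 2 * i + 2)%:Z]
  else [:: - (2 * k - i)%:Z; (k + i + 1)%:Z; - (2 * i - k + 1)%:Z]).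
Proof.
split=> [i im|i im|i im|i x im|i i' x im i'm].
- by case: ifP.
- by case: ifP => ik; rewrite !big_cons big_nil; lia.
- by case: ifP => ik /=; rewrite !inE; lia.
- by case: ifP => ik; rewrite !inE; lia.
- by case: ifP => ik; case: ifP => ik'; rewrite !inE; lia.
Qed.

(** Within each half of the rows for [r = 3], row [i] keeps its displacement but takes the other two
    entries of row [s i]. The sum becomes [i - s i], which two labels from a fresh block of length
    [k] cancel, one block per half. *)
Lemma zero_sum_rows5 k s : derangement k s ->
  zero_sum_rows (2 * k) (5 * k) 5 (fun i =>
  if (i < k)%N then [:: (i + 1)%:Z; (k + s i + 1)%:Z; - (k + 2 * s i + 2)%:Z;
    (3 * k + s i + 1)%:Z; - (3 * k + i + 1)%:Z]
  else let j := (i - k)%N in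
    [:: - (k - j)%:Z; (2 * k + s j + 1)%:Z; - (k + 2 * s j + 1)%:Z;
    (4 * k + s j + 1)%:Z; - (4 * k + j + 1)%:Z]).
Proof.
move=> ds; split=> [i im|i im|i im|i x im|i i' x im i'm].
- by case: ifP.
- case: ifP => ik.
    by have [sm si _] := ds i ik; rewrite !big_cons big_nil; lia.
  have jk : (i - k < k)%N by lia.
  by have [sm si _] := ds _ jk; rewrite /= !big_cons big_nil; lia.
- case: ifP => ik.
    by have [sm si _] := ds i ik; rewrite /= !inE; lia.
  have jk : (i - k < k)%N by lia.
  by have [sm si _] := ds _ jk; rewrite /= !inE; lia.
- case: ifP => ik.
    by have [sm si _] := ds i ik; rewrite /= !inE; lia.
  have jk : (i - k < k)%N by lia.
  by have [sm si _] := ds _ jk; rewrite /= !inE; lia.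
- case: ifP => ik; case: ifP => ik'.
  + have [sm si /(_ _ ik') sinj] := ds i ik.
    by have [sm' si' _] := ds i' ik'; rewrite !inE; lia.
  + have jk' : (i' - k < k)%N by lia.
    have [sm si _] := ds i ik.
    by have [sm' si' _] := ds _ jk'; rewrite /= !inE; lia.
  + have jk : (i - k < k)%N by lia.
    have [sm si _] := ds _ jk.
    by have [sm' si' _] := ds _ ik'; rewrite /= !inE; lia.
  + have jk : (i - k < k)%N by lia.
    have jk' : (i' - k < k)%N by lia.
    have [sm si /(_ _ jk') sinj] := ds _ jk.
    by have [sm' si' _] := ds _ jk'; rewrite /= !inE; lia.
Qed.

(** These are the four-entry rows of [zero_sum_rows_add4] with [n = 0], where [i + 1] is replaced by
    [p i + 1] and the change is cancelled by two labels above [2 * m]. The entries [p i + 1] and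
    [- (s i + 1)] must not be opposite, hence the condition that [p] and [s] never agree. *)
Lemma zero_sum_rows6 m s p : derangement m s -> derangement m p ->
  (forall i, (i < m)%N -> p i <> s i) ->
  zero_sum_rows m (3 * m) 6 (fun i =>
    [:: (p i + 1)%:Z; (2 * m - i)%:Z; - (s i + 1)%:Z; - (2 * m - s i)%:Z;
        (2 * m + i + 1)%:Z; - (2 * m + p i + 1)%:Z]).
Proof.
move=> ds dp ps; split=> [i im|i im|i im|i x im|i i' x im i'm] //.
- have [sm si _] := ds i im; have [pm pi _] := dp i im.
  by rewrite !big_cons big_nil; lia.
- have [sm si _] := ds i im; have [pm pi _] := dp i im; have := ps i im.
  by rewrite /= !inE; lia.
- have [sm si _] := ds i im; have [pm pi _] := dp i im.
  by rewrite /= !inE; lia.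
- have [sm si /(_ _ i'm) sinj] := ds i im.
  have [sm' si' _] := ds i' i'm.
  have [pm pi /(_ _ i'm) pinj] := dp i im.
  have [pm' pi' _] := dp i' i'm.
  rewrite !inE => /or4P[/eqP->|/eqP->|/eqP->|/or3P[]/eqP->]; lia.
Qed.

Lemma zero_sum_rows_add4s m n r R q : (1 < m)%N -> zero_sum_rows m n r R ->
  exists R', zero_sum_rows m (n + 2 * m * q) (r + 4 * q) R'.
Proof.
move=> m1 HR; elim: q => [|q [R' HR']]; first by exists R; rewrite !muln0 !addn0.
have -> : (n + 2 * m * q.+1 = n + 2 * m * q + 2 * m)%N by lia.
have -> : (r + 4 * q.+1 = r + 4 * q + 4)%N by lia.
have HR4 := zero_sum_rows_add4 (cyc_succ_derangement m1) HR'.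
by eexists; exact: HR4.
Qed.

Lemma zero_sum_rows_exist m n r : (3 <= m)%N -> (3 <= r)%N ->
  (m * r = 2 * n)%N -> exists R, zero_sum_rows m n r R.
Proof.
move=> m3 r3 mrn; have m1 : (1 < m)%N by lia.
suff [n0 [r0 [q [R0 [HR rE mr0]]]]] : exists n0 r0 q R,
    [/\ zero_sum_rows m n0 r0 R, r = (r0 + 4 * q)%N & (m * r0 = 2 * n0)%N].
  have [R HR'] := zero_sum_rows_add4s q m1 HR; rewrite rE; exists R.
  suff -> : n = (n0 + 2 * m * q)%N by [].
  by move: mrn; rewrite rE mulnDr mr0; lia.
(* The residues 0, 1, 2, 3 start from [r0] = 0, 5, 6, 3. Since [r >= 3], residues 1 and 2 give
   [r >= 5], so that [r %/ 4 - 1] is not truncated. *)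
have r4 : r = (r %% 4 + 4 * (r %/ 4))%N by lia.
have ev : odd r -> m = (2 * m./2)%N.
  by move=> odr; have := congr1 odd mrn; rewrite !oddM odr; lia.
have : (r %% 4 < 4)%N by lia.
case E : (r %% 4)%N r4 => [|[|[|[|?]]]] // r4 _.
- exists 0%N, 0%N, (r %/ 4)%N, (fun=> [::]); split; [|lia|lia].
  exact: zero_sum_rows_nil.
- rewrite ev; last lia.
  have k2 : (1 < m./2)%N by lia.
  have H5 := zero_sum_rows5 (cyc_succ_derangement k2).
  by do 2!eexists; exists (r %/ 4 - 1)%N; eexists; split; [exact: H5|lia|lia].
(* The cyclic shifts by one and by two differ everywhere, because a shift by one has no fixed
   point. *)
- have H6 : forall i, (i < m)%N -> cyc_succ m (cyc_succ m i) <> cyc_succ m i.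
    move=> i im; rewrite {2 3}/cyc_succ; case: ifP => _ ; rewrite /cyc_succ;
    case: ifP; lia.
  have H := zero_sum_rows6 (cyc_succ_derangement m1)
    (cyc_succ2_derangement m3) H6.
  by do 2!eexists; exists (r %/ 4 - 1)%N; eexists; split; [exact: H|lia|lia].
- rewrite ev; last lia.
  by do 2!eexists; exists (r %/ 4)%N; eexists; split;
    [exact: zero_sum_rows3|lia|lia].
Qed.

(** * From zero-sum rows to an array *)

Lemma uniq_map_inj_in (S T : eqType) (f : S -> T) (s : seq S) :
  uniq (map f s) -> {in s &, injective f}.
Proof.
elim: s => //= a s IHs /andP[fa us] x y; rewrite !inE.
case/orP=> [/eqP->|xs] /orP[/eqP->|ys] // fxy; last exact: IHs.
  by case/negP: fa; rewrite fxy map_f.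
by case/negP: fa; rewrite -fxy map_f.
Qed.

(** By counting: the rows together list [m * r] distinct elements of a set [X] of size
    [2 * n = m * r], hence all of it. *)
Lemma zero_sum_rows_cover m n r R x : (m * r = 2 * n)%N ->
  zero_sum_rows m n r R -> (0 < `|x|%N <= n)%N ->
  exists2 i, (i < m)%N & x \in R i.
Proof.
move=> mrn [Rsz Rsum Runiq Rbd Rinj] xn.
pose L := [seq y | i <- iota 0 m, y <- R i].
pose X := [seq k.+1%:Z | k <- iota 0 n] ++ [seq - k.+1%:Z | k <- iota 0 n].
have memX y : (y \in X) = (0 < `|y|%N <= n)%N.
  rewrite mem_cat; apply/orP/idP => [[]/mapP[k]|yn].
  - by rewrite mem_iota => kn ->; lia.
  - by rewrite mem_iota => kn ->; lia.
  - case: (lerP 0 y) => y0; [left|right]; apply/mapP; exists (`|y|%N.-1);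
      rewrite ?mem_iota; lia.
have uL : uniq L.
  apply: allpairs_uniq_dep => [|i|]; first exact: iota_uniq.
    rewrite mem_iota => im; have {}im : (i < m)%N by lia.
    exact: map_uniq (Runiq _ im).
  move=> _ _ /allpairsPdep[i [y [im yi ->]]] /allpairsPdep[i' [y' [im' yi' ->]]].
  rewrite /= => eyy; subst y'; rewrite !mem_iota in im im'.
  by have -> : i = i' by apply: (Rinj _ _ y) => //; lia.
have LX : {subset L <= X}.
  move=> y /allpairsPdep[i [z [im zi ->]]]; rewrite memX.
  by rewrite mem_iota in im; apply: (Rbd i) => //; lia.
have szL : size L = (m * r)%N.
  rewrite size_allpairs_dep sumnE big_map big_seq (eq_bigr (fun=> r)).
    by rewrite -big_seq big_const_seq count_predT size_iota iter_addn_0 mulnC.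
  by move=> i; rewrite mem_iota => im; apply: Rsz; lia.
have szX : size X = (2 * n)%N by rewrite size_cat !size_map size_iota; lia.
have [|_ eLX] := uniq_min_size uL LX; first by rewrite szX szL mrn.
move: xn; rewrite -memX -eLX => /allpairsPdep[i [y [im yi ->]]].
by exists i => //; rewrite mem_iota in im; lia.
Qed.

(** Column [j], counted from 0, is reserved for the labels of absolute value [j + 1]. *)
Definition rows_array (m n : nat) (R : nat -> seq int) : 'M[option int]_(m, n) :=
  \matrix_(i, j) if j.+1%:Z \in R i then Some j.+1%:Z
                 else if - j.+1%:Z \in R i then Some (- j.+1%:Z) else None.

Lemma rows_arrayP m n r R (i : 'I_m) (j : 'I_n) x : zero_sum_rows m n r R ->
  rows_array m n R i j = Some x <-> x \in R i /\ `|x|%N = j.+1.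
Proof.
move=> HR; have inj := uniq_map_inj_in (zsr_uniq HR (ltn_ord i)).
rewrite mxE; split=> [|[xi xj]].
  by case: ifP => [xi [<-]|_]; last case: ifP => // xi [<-]; split=> //; lia.
have [xE|xE] : x = j.+1%:Z \/ x = - j.+1%:Z by lia.
  by rewrite -xE xi.
rewrite -xE xi ifN //; apply/negP => yi.
by have := inj _ _ xi yi; lia.
Qed.

(** Sending [x] to column [|x| - 1] is a bijection from the entries of [R i] to the filled cells of
    row [i]. The general operation serves both to count these cells ([F] constantly 1) and to sum
    them ([F] the identity). *)
Lemma big_rows_array m n r R V (idx : V) (op : Monoid.com_law idx)
    (F : int -> V) (i : 'I_m) : zero_sum_rows m n r R ->
  \big[op/idx]_(j < n) oapp F idx (rows_array m n R i j) =
  \big[op/idx]_(x <- R i) F x.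
Proof.
move=> HR; have inj := uniq_map_inj_in (zsr_uniq HR (ltn_ord i)).
have uR := map_uniq (zsr_uniq HR (ltn_ord i)).
(* Both sides are a double sum over the pairs with [|x| = j + 1], taken in either order. *)
transitivity (\big[op/idx]_(j < n) \big[op/idx]_(x <- R i | `|x|%N == j.+1) F x).
  apply: eq_bigr => j _; case E : (rows_array m n R i j) => [x|] /=.
    have [xi xj] := (rows_arrayP i j x HR).1 E.
    rewrite -big_filter (_ : filter _ _ = [:: x]) ?big_seq1 //.
    apply: perm_small_eq => //; apply: uniq_perm => // [|y].
      exact: filter_uniq.
    rewrite mem_filter inE; apply/andP/eqP => [[/eqP yj yi]|-> ].
      by apply: inj => //; lia.
    by split=> //; apply/eqP.
  rewrite big_seq_cond big1 // => x /andP[xi /eqP xj].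
  by have := (rows_arrayP i j x HR).2 (conj xi xj); rewrite E.
rewrite (exchange_big_dep xpredT) //= [RHS]big_seq big_seq.
apply: eq_bigr => x xi; have xb := zsr_bound HR (ltn_ord i) xi.
have jn : (`|x|%N.-1 < n)%N by lia.
rewrite (big_pred1 (Ordinal jn)) // => j /=.
by apply/eqP/eqP => [xj|->]; [apply: val_inj => /=; lia|rewrite /=; lia].
Qed.

Lemma rows_array_SMR m n r R : (m * r = 2 * n)%N ->
  zero_sum_rows m n r R -> is_SMR r 2 (rows_array m n R).
Proof.
move=> mrn HR.
(* Both [j + 1] and its opposite occur by the covering lemma, each in a single row. *)
have pair_col (j : 'I_n) : exists i1 i2 : 'I_m, [/\ i1 != i2,
    rows_array m n R i1 j = Some j.+1%:Z,
    rows_array m n R i2 j = Some (- j.+1%:Z) &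
    forall i, i != i1 -> i != i2 -> rows_array m n R i j = None].
  have [|i1 im1 xi1] := @zero_sum_rows_cover _ _ _ _ j.+1%:Z mrn HR.
    by have := ltn_ord j; lia.
  have [|i2 im2 xi2] := @zero_sum_rows_cover _ _ _ _ (- j.+1%:Z) mrn HR.
    by have := ltn_ord j; lia.
  have E1 : rows_array m n R (Ordinal im1) j = Some j.+1%:Z.
    by apply/(rows_arrayP _ _ _ HR); split=> //; lia.
  have E2 : rows_array m n R (Ordinal im2) j = Some (- j.+1%:Z).
    by apply/(rows_arrayP _ _ _ HR); split=> //; lia.
  exists (Ordinal im1), (Ordinal im2); split=> //.
    by apply/eqP => e; move: E1; rewrite e E2 => -[]; lia.
  move=> i ni1 ni2; case E : (rows_array m n R i j) => [x|] //.
  have [xi xj] := (rows_arrayP i j x HR).1 E.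
  have [xE|xE] : x = j.+1%:Z \/ x = - j.+1%:Z by lia.
    case/eqP: ni1; apply: val_inj; apply: (zsr_inj HR _ _ _ xi1) => //=.
    by rewrite -xE.
  case/eqP: ni2; apply: val_inj; apply: (zsr_inj HR _ _ _ xi2) => //=.
  by rewrite -xE.
split=> [i|j|x xX|i|j].
- rewrite -sum1dep_card -(zsr_size HR (ltn_ord i)) -sum1_size.
  rewrite -(big_rows_array _ (fun=> 1%N) i HR) big_mkcond.
  by apply: eq_bigr => j _; case: (rows_array m n R i j).
- have [i1 [i2 [i12 E1 E2 E0]]] := pair_col j.
  rewrite (_ : [set i | _] = [set i1; i2]) ?cards2 ?i12 //.
  apply/setP=> i; rewrite !inE.
  by have [->|n1] := eqVneq i i1; [rewrite E1|
     have [->|n2] := eqVneq i i2; [rewrite E2|rewrite E0]].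
- have xn : (0 < `|x|%N <= n)%N by move: xX; rewrite unfold_in mrn; case: ifP; lia.
  have [i im xi] := zero_sum_rows_cover mrn HR xn.
  have jn : (`|x|%N.-1 < n)%N by lia.
  rewrite (_ : [set ij | _] = [set (Ordinal im, Ordinal jn)]) ?cards1 //.
  apply/setP=> -[i' j']; rewrite !inE /=; apply/eqP/eqP => [E|[-> ->]].
    have [xi' xj'] := (rows_arrayP i' j' x HR).1 E.
    congr pair; apply: val_inj => /=; last lia.
    exact: (zsr_inj HR _ _ xi' xi).
  by apply/(rows_arrayP _ _ _ HR); split=> //=; lia.
- rewrite -[RHS](zsr_sum HR (ltn_ord i)) -(big_rows_array _ id i HR).
  by apply: eq_bigr => j _; case: (rows_array m n R i j).
- have [i1 [i2 [i12 E1 E2 E0]]] := pair_col j.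
  rewrite (bigD1 i1) //= (bigD1 i2) 1?eq_sym //= E1 E2 big1 /= => [|i /andP[n1 n2]].
    lia.
  by rewrite E0.
Qed.

(** * Necessary conditions on [m], [n] and [r] *)

Lemma SMR_filled_count m n r s (A : 'M[option int]_(m, n)) :
  is_SMR r s A -> (m * r = n * s)%N.
Proof.
move=> HA.
have -> : (m * r = \sum_(i < m) \sum_(j < n | A i j != None) 1)%N.
  rewrite (eq_bigr (fun=> r)) ?sum_nat_const ?card_ord // => i _.
  by rewrite sum1dep_card (smr_row_filled HA).
rewrite (exchange_big_dep xpredT) //=.
rewrite (eq_bigr (fun=> s)) ?sum_nat_const ?card_ord // => j _.
by rewrite sum1dep_card (smr_col_filled HA).
Qed.

Lemma SMR_entry m n r s (A : 'M[option int]_(m, n)) x :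
  is_SMR r s A -> x \in smr_entries m r -> exists i j, A i j = Some x.
Proof.
move=> HA /(smr_once HA)/eqP/cards1P[[i j] /setP/(_ (i, j))].
by rewrite !inE eqxx => /eqP; exists i, j.
Qed.

Lemma SMR_entry_inj m n r s (A : 'M[option int]_(m, n)) x i j i' j' :
  is_SMR r s A -> x \in smr_entries m r ->
  A i j = Some x -> A i' j' = Some x -> i = i' /\ j = j'.
Proof.
move=> HA /(smr_once HA)/eqP/cards1P[p /setP Ep] E E'.
have := Ep (i, j); have := Ep (i', j'); rewrite !inE /= E E' eqxx.
by move=> /esym/eqP <- /esym/eqP [<- <-].
Qed.

(** Stated over a finite type so as to apply to any column and, when [r = 2], to a row. *)
Lemma zero_sum_pair_opp (T : finType) (f : T -> option int) t a :
  #|[set u | f u != None]| = 2 -> \sum_u odflt 0 (f u) = 0 -> f t = Some a ->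
  exists2 u, u != t & f u = Some (- a).
Proof.
move=> /eqP/cards2P[x [y [xy Exy]]] sum0 ft.
wlog tx : x y xy Exy / t = x => [wl|].
  have : t \in [set x; y] by rewrite -Exy inE ft.
  rewrite !inE => /orP[] /eqP; first exact: (wl x y).
  by apply: (wl y x); rewrite 1?eq_sym // setUC.
have yS : y \in [set u | f u != None] by rewrite Exy !inE eqxx orbT.
exists y; first by rewrite tx eq_sym.
move: yS; rewrite inE; case fy : (f y) => [b|] // _.
move: sum0; rewrite (bigD1 x) //= (bigD1 y) 1?eq_sym //= -tx ft fy big1 /=.
  by move=> sum0; congr Some; lia.
move=> u /andP[ux uy]; have := in_set2 u x y; rewrite -Exy inE -tx.
by rewrite (negPf ux) (negPf uy); case: (f u).
Qed.

Lemma SMR_entriesE m n r (A : 'M[option int]_(m, n)) x :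
  is_SMR r 2 A -> (x \in smr_entries m r) = (0 < `|x|%N <= n)%N.
Proof.
by move=> /SMR_filled_count mrn; rewrite unfold_in mrn; case: ifP; lia.
Qed.

(** For [r = 1] the row of the entry 1 has sum 1. For [r = 2] the entry -1 would occur twice: in the
    row of 1 and in its column. *)
Lemma SMR_row_size m n r (A : 'M[option int]_(m, n)) : (0 < n)%N ->
  (0 < r)%N -> is_SMR r 2 A -> (3 <= r)%N.
Proof.
move=> n0 r0 HA.
have x1 : 1%:Z \in smr_entries m r by rewrite (SMR_entriesE _ HA); lia.
have y1 : - 1%:Z \in smr_entries m r by rewrite (SMR_entriesE _ HA); lia.
have [i [j Eij]] := SMR_entry HA x1.
have rsz := smr_row_filled HA i; have rsum := smr_row_sum HA i.
have csz := smr_col_filled HA j; have csum := smr_col_sum HA j.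
case: r r0 => [|[|[|r]]] // _ in HA x1 y1 rsz rsum *.
  move: rsum; rewrite (bigD1 j) //= Eij big1 //= => j' jj'.
  have jS : j \in [set j | A i j != None] by rewrite inE Eij.
  move/eqP/cards1P: rsz => [k Sk]; move: jS; rewrite Sk inE => /eqP jk.
  by have := in_set1 j' k; rewrite -Sk inE -jk (negPf jj'); case: (A i j').
have [j' jj' Ej'] := zero_sum_pair_opp rsz rsum Eij.
have [i' ii' Ei'] := zero_sum_pair_opp csz csum Eij.
by have [_ /eqP] := SMR_entry_inj HA y1 Ej' Ei'; rewrite (negPf jj').
Qed.

Lemma sum_succ_mod4 n : ~~ odd (\sum_(k < n) k.+1)%N ->
  n = 0 %[mod 4] \/ n = 3 %[mod 4].
Proof.
have sumE : (2 * \sum_(k < n) k.+1 = n * n.+1)%N.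
  by elim: n => [|n IHn]; rewrite ?big_ord0 // big_ord_recr /= mulnDr IHn; lia.
move=> ev; have {sumE} : ((n * n.+1) %% 4 = 0)%N by rewrite -sumE; lia.
rewrite -modnMm -(addn1 n) -(modnDml n 1).
have : (n %% 4 < 4)%N by lia.
by case: (n %% 4)%N => [|[|[|[|?]]]] //; [left|right].
Qed.

Lemma odd_sum_abs n (g : 'I_n -> int) :
  odd `|(\sum_k g k)%R|%N = odd (\sum_k absz (g k))%N.
Proof.
apply: (big_rec2 (fun (x : int) (y : nat) => odd `|x|%N = odd y)) => // k x y _.
by rewrite oddD => <-; lia.
Qed.

(** Every column is [a] over [-a], so the first row contains exactly one of [k] and [-k] for each
    [k] from 1 to [n]; its sum is 0, hence [1 + ... + n] is even. *)
Lemma SMR_two_rows n r (A : 'M[option int]_(2, n)) : is_SMR r 2 A ->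
  n = 0 %[mod 4] \/ n = 3 %[mod 4].
Proof.
move=> HA; apply: sum_succ_mod4.
have ex_col (k : 'I_n) : exists j : 'I_n, exists2 a, A ord0 j = Some a &
    `|a|%N = k.+1.
  have xk : k.+1%:Z \in smr_entries 2 r.
    by rewrite (SMR_entriesE _ HA); have := ltn_ord k; lia.
  have [i [j Eij]] := SMR_entry HA xk; exists j.
  have [i0|i0] := eqVneq i ord0; first by exists k.+1%:Z; rewrite -?i0.
  have [i' ii' Ei'] :=
    zero_sum_pair_opp (smr_col_filled HA j) (smr_col_sum HA j) Eij.
  exists (- k.+1%:Z); last by lia.
  rewrite -Ei'; congr (A _ j); apply: val_inj => /=.
  have := ltn_ord i; have := ltn_ord i'.
  by move: ii' i0; rewrite -!val_eqE /=; lia.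
(* The entry +-(k+1) of the first row lies in column [h k]. *)
have [h hP] := fin_all_exists ex_col.
have h_inj : injective h.
  move=> k k' hk; have [a Ea ak] := hP k; have [a' Ea' ak'] := hP k'.
  move: Ea; rewrite hk Ea' => -[aa]; apply: val_inj => /=; lia.
(* An injective [h] permutes the columns, and reindexing along it puts the first row in order of
   absolute value. *)
have := smr_row_sum HA ord0; rewrite (reindex_inj h_inj) /= => /(congr1 absz).
move=> /(congr1 odd); rewrite odd_sum_abs /= => sum0.
rewrite (eq_bigr (fun k => `|odflt 0%R (A ord0 (h k))|%N)) ?sum0 // => k _.
by have [a -> <-] := hP k.
Qed.

Local Close Scope ring_scope.

Theorem mainTheorem1 (m n r : nat) (hm : (0 < m)%N) (hn : (0 < n)%N)
    (hr : (0 < r)%N) :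
  (exists A : 'M[option int]_(m, n), is_SMR r 2 A) <->
  ((m = 2 /\ n = r /\ (r = 0 %[mod 4] \/ r = 3 %[mod 4])) \/
   ((3 <= m)%N /\ (3 <= r)%N /\ (m * r = 2 * n)%N)).
Proof.
split=> [[A HA]|H].
  have mrn := SMR_filled_count HA; have r3 := SMR_row_size hn hr HA.
  have m2 : (1 < m)%N.
    by have := max_card [set i | A i (Ordinal hn) != None];
       rewrite (smr_col_filled HA) card_ord.
  have [m3|] := ltnP 2 m; [right; split=> //; split=> //; lia|left].
  have m2E : m = 2 by lia.
  subst m; have nr : n = r by lia.
  by split=> //; split=> //; rewrite -nr; apply: SMR_two_rows HA.
suff [R HR mrn] : exists2 R, zero_sum_rows m n r R & (m * r = 2 * n)%N.
  by exists (rows_array m n R); apply: rows_array_SMR.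
move: H => [[-> [-> rmod]]|[m3 [r3 mrn]]]; last first.
  by have [R HR] := zero_sum_rows_exist m3 r3 mrn; exists R.
have m2 : (1 < 2)%N by [].
(* With [m = 2] each extension adds four labels and four entries per row, so [n = r] is preserved
   from the starting values 0 and 3. *)
case: rmod => rmod.
  have [R] := zero_sum_rows_add4s (r %/ 4) m2 (zero_sum_rows_nil 2).
  have -> : (0 + 4 * (r %/ 4) = r)%N by lia.
  by exists R.
have [R] := zero_sum_rows_add4s (r %/ 4) m2 (zero_sum_rows3 1).
have -> : (3 + 4 * (r %/ 4) = r)%N by lia.
by exists R.
Qed.
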